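(* Let $B$ be a square integer matrix and let $m\geq 2$ be an integer. Then there exist integers $k>l\geq 0$ such that every entry of the matrix $B^k-B^l$ is divisible by $m$.
   Context: $B^0$ denotes the identity matrix. *)

(* Defs.v *)
From mathcomp Require Export all_boot all_order all_algebra.

Set Implicit Arguments.
Unset Strict Implicit.
Unset Printing Implicit Defensive.

(* Main.v *)
Require Import Defs.
From mathcomp Require Import all_boot all_order all_algebra.
Import Order.TTheory GRing.Theory Num.Theory.
Local Open Scope ring_scope.

(** Reducing every entry modulo [m] sends the powers of [B] into a finite set of matrices, so by
    pigeonhole ([sequence_repeats]) two powers have the same reduction, and their difference
    vanishes modulo [m]. *)

Lemma sequence_repeats {T : finType} (f : nat -> T) :
  exists k l : nat, (l < k)%N /\ f k = f l.
Proof.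
(* Already the first [#|T| + 1] terms cannot be pairwise distinct. *)
have /injectivePn[x [y neq_xy eq_f]] :
    ~~ injectiveb (fun i : 'I_#|T|.+1 => f i).
  by apply/injectiveP => /leq_card; rewrite card_ord ltnn.
case: (ltngtP x y) => [lt_xy|lt_yx|/val_inj eq_xy].
- by exists y, x.
- by exists x, y.
- by rewrite eq_xy eqxx in neq_xy.
Qed.

Theorem corollary5p10 (n : nat) (B : 'M[int]_n) (m : int) (hm : 2 <= m) :
  exists k l : nat, (l < k)%N /\
    forall i j : 'I_n, (m %| (B ^+ k - B ^+ l) i j)%Z.
Proof.
have m_gt0 : 0 < m by apply: lt_le_trans hm.
(* [inord] needs a bound of successor form; remainders lie below [m], so its default value never
   interferes. *)
pose residue (a : int) : 'I_`|m|.+1 := inord `|(a %% m)%Z|.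
have residueK a : (residue a)%:Z = (a %% m)%Z.
  have mod_ge0 : 0 <= (a %% m)%Z by rewrite modz_ge0 // gt_eqF.
  rewrite inordK ?gez0_abs // ltnS ltnW //.
  by rewrite -ltz_nat !gez0_abs ?ltz_pmod ?(ltW m_gt0).
(* Matrices over a finite type form a finite type. *)
have [k [l [lt_lk eq_kl]]] :=
  sequence_repeats (fun k => map_mx residue (B ^+ k)).
exists k, l; split=> // i j.
have /(congr1 (fun r : 'I__ => r%:Z)) := congr1 (fun A : 'M__ => A i j) eq_kl.
by rewrite !mxE !residueK => /eqP; rewrite eqz_mod_dvd.
Qed.
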